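(* Let $G$ be a semitopological group with a coherent covering $\mathcal{C}$ by closed symmetric subsets such that, for any $A,B\in\mathcal{C}$, there is $C\in\mathcal{C}$ with $AB\subseteq C$. Let $V\in\mathcal{C}$ be a generic piece, i.e. $[W:V]$ is finite for every $W\in\mathcal{C}$. Then $V$ has non-empty interior. In particular, if $V$ is compact Hausdorff with the subspace topology, then $G$ is a locally compact topological group. Furthermore, if $\mathcal{C}$ is a countable covering by compact Hausdorff subsets, then $G$ is locally compact Hausdorff if and only if $\mathcal{C}$ contains a generic piece.
   Context: A semitopological group is a group with a $T_1$ topology in which all left and right translations are continuous. A covering of a topological space $X$ is a family $\mathcal{C}$ of subsets with union $X$; it is coherent if a set $U\subseteq X$ is open exactly when $U\cap C$ is open in $C$ for every $C\in\mathcal{C}$. A subset $S$ of a group is symmetric if $1\in S=S^{-1}$. For subsets $X,Y$ of a group, $[X:Y]=\min\{|\Delta|:X\subseteq\Delta Y\}$. Topological groups are assumed Hausdorff. *)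

(* Defs.v *)
From HB Require Import structures.
From mathcomp Require Import all_boot.
From mathcomp Require Import boolp classical_sets functions cardinality.
From mathcomp Require Import topology.

Set Implicit Arguments.
Unset Strict Implicit.
Unset Printing Implicit Defensive.

Local Open Scope classical_set_scope.
Local Open Scope group_scope.

(* A group carrying a topology, with no compatibility assumed between them. *)
#[short(type="groupTopologyType")]
HB.structure Definition GroupTopology := {G of Group G & Topological G}.

Section GroupTopologyDefs.
Context (G : groupTopologyType).

Definition semitopological_group :=
  [/\ accessible_space G,
      forall a : G, continuous (fun x : G => a * x)
    & forall a : G, continuous (fun x : G => x * a)].

Definition topological_group :=
  [/\ hausdorff_space G,
      continuous (fun p : G * G => p.1 * p.2)
    & continuous (fun x : G => x^-1)].

End GroupTopologyDefs.

Arguments semitopological_group : clear implicits.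
Arguments topological_group : clear implicits.

Section Coverings.
Context {T : topologicalType}.
Implicit Types (C : set (set T)) (U A : set T).

Definition covering C := \bigcup_(A in C) A = [set: T].

(* [set_type A] carries the subspace topology, and the trace of U on A is
   given as the preimage of U under the inclusion of [set_type A] into T. *)
Definition coherent C := forall U,
  open U <->
  (forall A, C A -> open ((set_val : set_type A -> T) @^-1` U)).

End Coverings.

Definition compact_hausdorff (T : topologicalType) :=
  compact [set: T] /\ hausdorff_space T.

Section GroupSets.
Context {G : groupType}.
Implicit Types (C : set (set G)) (S V W X Y D E : set G).

Definition mulset X Y : set G := [set x * y | x in X & y in Y].

Definition invset X : set G := [set x^-1 | x in X].

Definition symmetric_set S := S 1 /\ S = invset S.

(* D is a set of left factors of least cardinality, i.e. |D| = [X : Y]. *)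
Definition realizes_index X Y D :=
  X `<=` mulset D Y /\ forall E, X `<=` mulset E Y -> (D #<= E)%card.

Definition finite_index X Y := exists2 D, realizes_index X Y D & finite_set D.

Definition generic_piece C V := C V /\ forall W, C W -> finite_index W V.

End GroupSets.

(* Main.v *)
(** Choose a maximal set D such that the translates aV, a in D, are pairwise
    disjoint. Then G = D V V, and D meets every W in C in a finite set because
    [W : V] is finite. As V V is covered by finitely many translates eV, G is
    the union of the sets aeV, of which only finitely many meet a given piece;
    by coherence the union of those missing 1 is closed, so finitely many
    translates of V cover a neighbourhood of 1, and V has interior.
    If V is moreover compact Hausdorff, then G is locally compact Hausdorff and
    Ellis' theorem applies. Joint continuity follows from a quasi-continuity
    property: every neighbourhood W of 1 has a point u with uNN inside W for
    some neighbourhood N of 1. Indeed, if z lies in the closure of all NN, then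
    uz is in the closure of W; letting u tend to 1 gives z = 1. The inverse has
    closed graph and V is a symmetric compact set with interior.
    Conversely, by Baire some piece of a countable covering has interior, and
    finitely many of its translates cover any compact set. *)
Require Import Defs.
From mathcomp Require Import all_boot.
From mathcomp Require Import boolp classical_sets functions cardinality.
From mathcomp Require Import topology.

Local Open Scope classical_set_scope.
Local Open Scope group_scope.

(** * Finite index, translations and finite closed covers *)

(** Well-ordering of the sizes of finite factor sets gives a smallest one; an infinite [E']
    dominates it because it contains a copy of the naturals. *)
Lemma finite_index_finite_cover (G : groupType) (X Y D : set G) :
  finite_set D -> X `<=` mulset D Y -> finite_index X Y.
Proof.
move=> /finite_setP[n Dn] XDY.
pose P m := `[< exists2 E : set G, X `<=` mulset E Y & (E #= `I_m)%card >].
have exP : exists m, P m by exists n; apply/asboolP; exists D.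
case: (ex_minnP exP) => m /asboolP[E XEY Em] minm.
exists E; last by apply/finite_setP; exists m.
split=> // E' XE'Y.
have [/finite_setP[k E'k]|/infiniteP natE'] := pselect (finite_set E').
  rewrite (card_le_eql Em) (card_le_eqr E'k) card_le_II.
  by apply: minm; apply/asboolP; exists E'.
by rewrite (card_le_eql Em); apply: card_le_trans natE'; apply: subset_card_le.
Qed.

Lemma nbhs_mull (G : groupTopologyType) (a x : G) (A : set G) :
  semitopological_group G -> nbhs (a * x) A -> nbhs x [set y | A (a * y)].
Proof. by move=> [_ cl _] nA; exact: cl nA. Qed.

Lemma nbhs_mulr (G : groupTopologyType) (a x : G) (A : set G) :
  semitopological_group G -> nbhs (x * a) A -> nbhs x [set y | A (y * a)].
Proof. by move=> [_ _ cr] nA; exact: cr nA. Qed.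

Lemma closed_mull (G : groupTopologyType) (a : G) (A : set G) :
  semitopological_group G -> closed A -> closed [set y | A (a * y)].
Proof.
by move=> [_ cl _]; apply: preimage_closed => ? _; apply: cl.
Qed.

Lemma closed_mulr (G : groupTopologyType) (a : G) (A : set G) :
  semitopological_group G -> closed A -> closed [set y | A (y * a)].
Proof.
by move=> [_ _ cr]; apply: preimage_closed => ? _; apply: cr.
Qed.

Lemma compact_mull (G : groupTopologyType) (a : G) (A : set G) :
  semitopological_group G -> compact A -> compact [set y | A (a * y)].
Proof.
move=> [_ cl _] cA.
have -> : [set y | A (a * y)] = ( *%g a^-1) @` A.
  rewrite eqEsubset; split=> [y Aay|_ [y Ay <-]] /=; last by rewrite mulVKg.
  by exists (a * y) => //; rewrite mulKg.
by apply: continuous_compact => //; apply: continuous_subspaceT; apply: cl.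
Qed.

(** Either [U] lies in the first set, or removing that closed set leaves a non-empty open set
    covered by the others. *)
Lemma finite_bigcup_interior (T : topologicalType) (I : choiceType)
    (D : set I) (F : I -> set T) (U : set T) :
  finite_set D -> (forall i, D i -> closed (F i)) ->
  open U -> U !=set0 -> U `<=` \bigcup_(i in D) F i ->
  exists2 i, D i & (F i)° !=set0.
Proof.
move=> /finite_seqP[s ->]; elim: s U => [|i s IHs] U cF oU U0 UF.
  by case: U0 => x /UF[].
have [UFi|] := pselect (U `<=` F i).
  exists i; first exact: mem_head.
  by case: U0 => x Ux; exists x; apply: (filterS UFi); apply: open_nbhs_nbhs.
move=> /existsNP[x /not_implyP[Ux nFx]].
have [||||j js Fj] := IHs (U `&` ~` F i).
- by move=> j js; apply: cF; rewrite /= inE js orbT.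
- by apply: openI => //; apply: closed_openC; apply: cF; exact: mem_head.
- by exists x.
- move=> y [/UF[j /=]]; rewrite inE => /orP[/eqP->//|js] Fj _.
  by exists j.
- by exists j => //=; rewrite inE js orbT.
Qed.

(** * Generic pieces of a coherent covering *)

Lemma symmetric_setV (G : groupType) (S : set G) x :
  symmetric_set S -> S x -> S x^-1.
Proof. by move=> [_ SE] Sx; rewrite SE; exists x. Qed.

(** Comparing traces with closed sets of the whole space keeps later arguments out of
    [set_type A]. *)
Lemma coherent_closed (T : topologicalType) (C : set (set T)) (B : set T) :
  coherent C ->
  (forall A, C A -> exists2 B' : set T, closed B' & B `&` A = B' `&` A) ->
  closed B.
Proof.
move=> coh BC; rewrite -openC; apply: (coh _).2 => A CA.
have [B' cB' BB'] := BC A CA.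
have -> : (set_val : set_type A -> T) @^-1` (~` B) = set_val @^-1` (~` B').
  apply/seteqP; split=> -[x xA]; rewrite /= set_valE /= => nB Bx; apply: nB.
    by have [] : (B `&` A) x by rewrite BB'; split=> //; exact: set_mem.
  by have [] : (B' `&` A) x by rewrite -BB'; split=> //; exact: set_mem.
by exists (~` B') => //; exact: closed_openC.
Qed.

Lemma generic_piece_interior (G : groupTopologyType) (C : set (set G))
    (V : set G) :
  semitopological_group G -> covering C -> coherent C ->
  (forall A, C A -> closed A) -> (forall A, C A -> symmetric_set A) ->
  (forall A B, C A -> C B -> exists2 D, C D & mulset A B `<=` D) ->
  generic_piece C V -> V° !=set0.
Proof.
move=> sG cov coh Ccl Csym Cmul [CV Vgen].
have inC x : exists2 A, C A & A x.
  have [A CA Ax] : (\bigcup_(A in C) A) x by rewrite cov.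
  by exists A.
have Vsym : forall x, V x -> V x^-1.
  by move=> x Vx; apply: symmetric_setV => //; exact: Csym.
have V1 : V 1 by have [] := Csym V CV.
pose F (a : G) := [set x | V (a^-1 * x)].
have FclT a : closed (F a) by apply: closed_mull => //; exact: Ccl.
have [D [_ tD maxD]] := ex_maximal_disjoint_subcollection F setT.
have finD W : C W -> finite_set (D `&` W).
  move=> CW; have [E [WE _] fE] := Vgen W CW.
  (* By symmetry of [V], [h e] selects an a in [D] with e in [F a]. Disjointness allows at most one,
     so the part of [D] in [W] lies in the image of [E]; elsewhere the default 1 is harmless. *)
  pose h e := xget 1 [set a | D a /\ V (e^-1 * a)].
  apply: (@sub_finite_set _ _ (h @` E)); last exact: finite_image.
  move=> a [Da /WE[e Ee [v Vv eva]]]; exists e => //.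
  have Dh : [set b | D b /\ V (e^-1 * b)] a by split=> //; rewrite -eva mulKg.
  have [Dhe Vhe] : [set b | D b /\ V (e^-1 * b)] (h e).
    by apply: xgetPex; exists a.
  apply: tD => //; exists e; split=> /=.
    by have := Vsym _ Vhe; rewrite invgM invgK.
  by have := Vsym _ Dh.2; rewrite invgM invgK.
have covD g : exists2 a, D a & mulset V V (a^-1 * g).
  have [Dg|nDg] := pselect (D g).
    by exists g => //; exists 1 => //; exists 1 => //; rewrite mulVg mulg1.
  (* By maximality [F g] meets some [F a], and a common point x splits a^-1 g as (a^-1 x)(x^-1
     g). *)
  apply: contrapT => /forall2NP noD; apply: (maxD (D `|` [set g])) => //.
    split; first exact: subsetUl.
    by move=> /(_ g) sub; apply/nDg/sub; right.
  have noF a : D a -> ~ (F a `&` F g !=set0).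
    move=> Da [x [Fa Fg]]; have [//|] := noD a; apply; exists (a^-1 * x) => //.
    exists (x^-1 * g); first by have := Vsym _ Fg; rewrite invgM invgK.
    by rewrite mulgA mulgK.
  move=> a b [Da|->] [Db|->] // ab; first exact: tD.
    by case: (noF a Da ab).
  by rewrite setIC in ab; case: (noF b Db ab).
have [W CW VVW] := Cmul V V CV CV.
have [E [WE _] fE] := Vgen W CW.
pose D0 := mulset D E.
have covD0 g : exists2 d, D0 d & F d g.
  have [a Da /VVW/WE[e Ee [v Vv eva]]] := covD g.
  exists (a * e); first by exists a => //; exists e.
  by rewrite /F /= invgM -mulgA -eva mulKg.
have finD0 A : C A -> finite_set (D0 `&` A).
  move=> CA.
  apply: (@sub_finite_set _ _
    (\bigcup_(e in E) ( *%g^~ e @` (D `&` [set a | A (a * e)])))).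
    by move=> _ [[a Da [e Ee <-]] Aae]; exists e => //; exists a.
  apply: bigcup_finite => // e Ee; apply: finite_image.
  (* With e in [B], a = (a e) e^-1 lies in the product of [A] and [B], hence in a piece [B'], which
     meets [D] in a finite set. *)
  have [B CB Be] := inC e; have [B' CB' ABB'] := Cmul A B CA CB.
  apply: sub_finite_set (finD _ CB') => a [Da /= Aae]; split=> //.
  apply: ABB'; exists (a * e) => //; exists e^-1; last by rewrite mulgK.
  by apply: symmetric_setV Be; exact: Csym.
have meetD0 A : C A -> exists2 A', C A' &
    forall d x, D0 d -> A x -> F d x -> (D0 `&` A') d.
  move=> CA; have [A' CA' AVA'] := Cmul A V CA CV.
  exists A' => // d x D0d Ax Fdx; split=> //; apply: AVA'.
  exists x => //; exists (x^-1 * d); last by rewrite mulVKg.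
  by have := Vsym _ Fdx; rewrite invgM invgK.
(* The translates missing 1; by [meetD0] and [finD0] only finitely many of them meet a given
   piece. *)
pose B := \bigcup_(d in D0 `&` [set d | ~ F d 1]) F d.
have Bcl : closed B.
  apply: coherent_closed coh _ => A CA; have [A' CA' FA'] := meetD0 A CA.
  exists (\bigcup_(d in (D0 `&` A') `&` [set d | ~ F d 1]) F d).
    apply: closed_bigcup => //.
    by apply: sub_finite_set (finD0 _ CA') => d [].
  rewrite eqEsubset; split=> x [[d [D0d nF1] Fdx] Ax]; split=> //.
    by exists d => //; split=> //; exact: FA' Fdx.
  by exists d => //; split=> //; have [] := D0d.
have nB1 : (~` B) 1 by move=> [d [_ nF1] F1].
(* If 1 is in [F d], then d is in [V] by symmetry, so finitely many translates cover the complement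
   of [B]. *)
have [|||||d _ [x Fx]] := @finite_bigcup_interior G G (D0 `&` V) F (~` B).
- exact: finD0.
- by move=> d _.
- exact: closed_openC.
- by exists 1.
- move=> x nBx; have [d D0d Fdx] := covD0 x; exists d => //; split=> //.
  have Fd1 : F d 1 by apply: contrapT => nF1; apply: nBx; exists d.
  by rewrite -(invgK d); apply: Vsym; rewrite /F /= mulg1 in Fd1.
exists (d^-1 * x); move: Fx; rewrite /interior /= -{1}(mulVKg d x).
move=> /(nbhs_mull _ _ _ _ sG); apply: filterS => y /=.
by rewrite /F /= mulKg.
Qed.

(** * Separation and local compactness inherited from a piece *)

Lemma compact_set_type (T : topologicalType) (V : set T) :
  compact [set: set_type V] -> compact V.
Proof.
move=> cV.
have -> : V = (set_val : set_type V -> T) @` setT.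
  apply/seteqP; split=> [x Vx|_ [[x xV] _ <-]].
    by exists (SigSub (mem_set Vx)).
  by rewrite set_valE /=; exact: set_mem.
apply: continuous_compact => //; apply: continuous_subspaceT.
exact: initial_continuous.
Qed.

(** Of two inseparable points, one is translated to an interior point [v] of [V]. The other then
    lands in [V] because [V] is closed, and separation inside [V] makes them equal. *)
Lemma hausdorff_set_type_interior (G : groupTopologyType) (V : set G) :
  semitopological_group G -> closed V -> hausdorff_space (set_type V) ->
  V° !=set0 -> hausdorff_space G.
Proof.
move=> sG Vcl VT2 [v Vv] p q pq.
have Vv1 := nbhs_singleton Vv.
pose a := v * p^-1; have ap : a * p = v by rewrite /a mulgVK.
have meet A B : nbhs v A -> nbhs (a * q) B -> A `&` B !=set0.
  rewrite -ap => /(nbhs_mull _ _ _ _ sG) nA /(nbhs_mull _ _ _ _ sG) nB.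
  by have [x [Ax Bx]] := pq _ _ nA nB; exists (a * x).
have Vq : V (a * q).
  apply: contrapT => nVq; have [|x [Vx]] := meet _ (~` V) Vv.
    by apply: open_nbhs_nbhs; split=> //; exact: closed_openC.
  exact.
have /(congr1 set_val) : SigSub (mem_set Vv1) = SigSub (mem_set Vq) :> set_type V.
  apply: VT2 => A B [_ [[A' oA' <-] A'v AA'] [_ [[B' oB' <-] B'q BB']]].
  rewrite !set_valE /= in A'v B'q.
  have [||x [[Vx A'x] B'x]] := meet (V `&` A') B'.
  - by apply: filterI => //; apply: open_nbhs_nbhs.
  - by apply: open_nbhs_nbhs.
  by exists (SigSub (mem_set Vx)); split; [apply: AA'|apply: BB'];
    rewrite /= set_valE.
by rewrite !set_valE /= -ap => /(can_inj (mulKg a)).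
Qed.

Lemma locally_compact_interior (G : groupTopologyType) (V : set G) :
  semitopological_group G -> closed V -> compact V -> V° !=set0 ->
  locally_compact [set: G].
Proof.
move=> sG Vcl Vc [v Vv] x _.
exists [set y | V (v * x^-1 * y)].
  rewrite withinET; apply: nbhs_mull => //; by rewrite mulgVK.
by split; [exact: compact_mull|exact: closed_mull].
Qed.

(** * Baire category and the index of compact sets *)

Lemma locally_compact_nbhs (T : topologicalType) (x : T) :
  locally_compact [set: T] -> exists2 K : set T, nbhs x K & compact K.
Proof. by move=> /(_ x I)[K + [cK _]]; rewrite withinET => nK; exists K. Qed.

Lemma closed_nbhs_sub (T : topologicalType) (x : T) (A : set T) :
  hausdorff_space T -> locally_compact [set: T] -> nbhs x A ->
  exists B : set T, [/\ nbhs x B, closed B & B `<=` A].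
Proof.
move=> T2 lcT nA; have [K nK cK] := locally_compact_nbhs T x lcT.
have [B nB BA] := compact_regular T2 cK nK nA.
exists (closure B); split=> //; last exact: closed_closure.
exact: filterS (@subset_closure _ B) nB.
Qed.

Lemma compact_seq_cluster (T : topologicalType) (K : set T) (x : nat -> T) :
  compact K -> (forall n, K (x n)) ->
  exists p, forall (A : set T) m,
    closed A -> (forall n, (m <= n)%N -> A (x n)) -> A p.
Proof.
move=> cK Kx; have [|p [_ clp]] := cK (x @ \oo) _.
  by exists 0%N => // n _; exact: Kx.
exists p => A m Acl Ax; apply: Acl => B; apply: clp.
by exists m => // n; exact: Ax.
Qed.

(** If no [F n] had interior, closed sets with interior could be nested inside a compact set, each
    stage avoiding one more [F n]; a cluster point of chosen elements would lie in no [F n]. *)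
Lemma baire_locally_compact (T : topologicalType) (F : nat -> set T) (x0 : T) :
  hausdorff_space T -> locally_compact [set: T] ->
  (forall n, closed (F n)) -> \bigcup_n F n = setT ->
  exists n, (F n)° !=set0.
Proof.
move=> T2 lcT Fcl Fcov; apply: contrapT => /forallNP F0.
pose St := {A : set T | closed A /\ A° !=set0}.
(* The first component counts the stages, so that the state itself tells which [F n] to avoid. *)
have step (s : nat * St) : {t : nat * St | t.1 = s.1.+1 /\
    sval t.2 `<=` sval s.2 `&` ~` F s.1}.
  apply: cid; case: s => n [A [Acl [x Ax]]] /=.
  have [y [Ay nFy]] : exists y, (A° `&` ~` F n) y.
    apply: contrapT => /forallNP AF; apply: (F0 n); exists x.
    apply: filterS (nbhs_interior Ax) => y Ay.
    by apply: contrapT => nFy; apply: (AF y).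
  have [|B [nB Bcl BA]] := @closed_nbhs_sub T y (A `&` ~` F n) T2 lcT.
    apply: filterI => //; apply: open_nbhs_nbhs; split=> //.
    exact: closed_openC.
  have B0 : closed B /\ B° !=set0 by split=> //; exists y.
  by exists (n.+1, exist _ B B0).
have [K nK cK] := locally_compact_nbhs T x0 lcT.
have [B [nB Bcl BK]] := closed_nbhs_sub T x0 K T2 lcT nK.
have B0 : closed B /\ B° !=set0 by split=> //; exists x0.
have [f [f0 fS]] := dependent_choice step (0%N, exist _ B B0).
pose S n := sval (f n).2.
have f1 n : (f n).1 = n by elim: n => [|n IHn]; [rewrite f0|rewrite (fS n).1 IHn].
have Smono m n : (m <= n)%N -> S n `<=` S m.
  elim: n => [|n IHn]; first by rewrite leqn0 => /eqP ->.
  rewrite leq_eqVlt => /orP[/eqP -> //|]; rewrite ltnS => /IHn SS.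
  by move=> x /(fS n).2[/SS].
have /choice[x Sx] : forall n, exists y, S n y.
  move=> n; case: (svalP (f n).2) => _ [y Sy].
  by exists y; exact: nbhs_singleton Sy.
have [|p Sp] := compact_seq_cluster T K x cK.
  move=> n; apply: BK; have := Smono 0%N n (leq0n n) _ (Sx n).
  by rewrite /S f0.
have SpT n : S n p.
  apply: (Sp _ n); first by case: (svalP (f n).2).
  by move=> k nk; exact: Smono nk _ (Sx k).
have [n _ Fp] : (\bigcup_n F n) p by rewrite Fcov.
by have [_] := (fS n).2 _ (SpT n.+1); rewrite f1.
Qed.

Lemma compact_finite_index (G : groupTopologyType) (W V : set G) :
  semitopological_group G -> compact W -> V° !=set0 -> finite_index W V.
Proof.
move=> sG cW [v Vv].
pose P (D : set G) x := finite_set D /\ mulset D V x.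
(* The filter of large finite sets, directed by inclusion: since x is interior to x v^-1 [V],
   compactness yields one finite set of factors for all of [W]. *)
pose Fi := filter_from (@finite_set G)
  (fun D => [set E | finite_set E /\ D `<=` E]).
have FF : Filter Fi.
  apply: filter_from_filter; first by exists set0; exact: finite_set0.
  move=> D E fD fE; exists (D `|` E); first by rewrite finite_setU.
  by move=> A [fA DEA]; split; split=> // x Hx; apply: DEA; [left|right].
have [|D fD DP] := (compact_near_coveringP W).1 cW _ Fi P FF.
  move=> x Wx; exists ([set y | V (v * x^-1 * y)],
    [set E | finite_set E /\ [set x * v^-1] `<=` E]).
    split=> /=; first by apply: nbhs_mull => //; rewrite mulgVK.
    by exists [set x * v^-1] => //; exact: finite_set1.
  move=> [y E] [/= Vy [fE Ex]]; split=> //; exists (x * v^-1); first exact: Ex.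
  exists (v * x^-1 * y) => //.
  by rewrite -!mulgA mulKg mulVKg.
apply: (@finite_index_finite_cover _ _ _ D) => // x.
by move=> /(DP D (conj fD (@subset_refl _ D)) x)[].
Qed.

(** * Ellis' theorem: continuity of multiplication and inversion *)

(* If no u and N exist, build u_n, y_n and neighbourhoods N_n of 1 with
   u_n N_n inside W1 decreasing, y_n in N_n and u_(n+1) N_(n+1) y_n outside W.
   Cluster points p of (u_n) and q of (y_n) then have p q both in W1 and outside
   the interior of W. *)
Lemma mul_quasi_continuous (G : groupTopologyType) (W : set G) :
  semitopological_group G -> hausdorff_space G -> locally_compact [set: G] ->
  nbhs 1 W -> exists u (N : set G),
    [/\ W u, nbhs 1 N & forall x y, N x -> N y -> W (u * x * y)].
Proof.
move=> sG T2 lcG; wlog Wcl : W / closed W.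
  move=> wlg nW; have [W' [nW' W'cl W'W]] := closed_nbhs_sub G 1 W T2 lcG nW.
  have [u [N [W'u nN NW']]] := wlg W' W'cl nW'.
  by exists u, N; split=> // [|x y Nx Ny]; apply: W'W => //; exact: NW'.
move=> nW; apply: contrapT => noN.
have [K nK cK] := locally_compact_nbhs G 1 lcG.
(* [K] confines both sequences to a compact set; the interior of [W] is used because its complement
   is closed and so passes to cluster points. *)
have [|W1 [nW1 W1cl W1W]] := closed_nbhs_sub G 1 (K `&` W°) T2 lcG.
  by apply: filterI => //; exact: nbhs_interior.
pose good (s : G * set G) :=
  [/\ nbhs 1 s.2, closed s.2 & forall z, s.2 z -> W1 (s.1 * z)].
pose R (s t : G * set G) y :=
  [/\ s.2 y, t.2 `<=` s.2, forall z, t.2 z -> s.2 (s.1^-1 * t.1 * z)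
    & forall z, t.2 z -> ~ W (t.1 * z * y)].
have step (s : sig good) : {t : sig good | exists y, R (sval s) (sval t) y}.
  apply: cid; case: s => -[u N] [/= nN Ncl NW1].
  have [x [y [Nx Ny nWuxy]]] : exists x y, [/\ N° x, N° y & ~ W (u * x * y)].
    apply: contrapT => none; apply: noN; exists u, N°; split.
    - have [] := W1W u; last by move=> _ /nbhs_singleton.
      by rewrite -(mulg1 u); apply: NW1; exact: nbhs_singleton.
    - exact: nbhs_interior.
    - move=> x y Nx Ny; apply: contrapT => nW'; apply: none.
      by exists x, y.
  (* The failing pair is split: x moves the base point from u to u x, and y is recorded as the
     factor that carries u x [N'] outside [W]. *)
  have [|N' [nN' N'cl N'N]] := closed_nbhs_sub G 1
      (N `&` [set z | N (x * z)] `&` [set z | ~ W (u * x * z * y)]) T2 lcG.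
    apply: filterI; first apply: filterI => //.
      by apply: nbhs_mull => //; rewrite mulg1.
    apply: (@nbhs_mull _ _ _ [set z | ~ W (z * y)]) => //; rewrite mulg1.
    apply: (@nbhs_mulr _ _ _ [set z | ~ W z]) => //.
    by apply: open_nbhs_nbhs; split=> //; exact: closed_openC.
  have gN' : good (u * x, N').
    split=> //= z /N'N[[_ Nxz] _].
    by rewrite -mulgA; exact: NW1.
  exists (exist _ _ gN'), y; split=> /=.
  - exact: nbhs_singleton.
  - by move=> z /N'N[[]].
  - by move=> z /N'N[[_ Nxz] _]; rewrite mulKg.
  - by move=> z /N'N[].
have g0 : good (1, W1) by split=> //= z; rewrite mul1g.
have [f [f0 fS]] := dependent_choice step (exist _ _ g0).
have [y Ry] := choice fS.
pose u n := (sval (f n)).1; pose N n := (sval (f n)).2.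
have Nnbhs n : nbhs 1 (N n) by case: (svalP (f n)).
have Ncl n : closed (N n) by case: (svalP (f n)).
have NW1 n z : N n z -> W1 (u n * z) by case: (svalP (f n)) => _ _; apply.
have Nmono m n : (m <= n)%N -> N n `<=` N m.
  elim: n => [|n IHn]; first by rewrite leqn0 => /eqP ->.
  rewrite leq_eqVlt => /orP[/eqP -> //|]; rewrite ltnS => /IHn NN.
  by have [_ NS _ _] := Ry n; move=> z /NS /NN.
have uN m n z : (m <= n)%N -> N n z -> N m ((u m)^-1 * u n * z).
  elim: n z => [|n IHn] z.
    by rewrite leqn0 => /eqP -> Nz; rewrite mulVg mul1g.
  rewrite leq_eqVlt => /orP[/eqP -> Nz|]; first by rewrite mulVg mul1g.
  rewrite ltnS => /IHn NN /=; have [_ _ NS _] := Ry n.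
  by move=> /NS /NN; rewrite -!mulgA mulVKg.
have N0 n z : N n z -> K z /\ K (u n * z).
  move=> Nz; split.
    have := Nmono 0%N n (leq0n _) _ Nz; rewrite /N f0 /= => /W1W[] //.
  by have /W1W[] := NW1 _ _ Nz.
have Ny n : N n (y n) by case: (Ry n).
have [|p Hp] := compact_seq_cluster G K u cK.
  move=> n; have [] := N0 n 1; first exact: nbhs_singleton.
  by rewrite mulg1.
have [|q Hq] := compact_seq_cluster G K y cK; first by move=> n; case: (N0 n (y n)).
(* For k at least n, u_k lies in the closed set u_n N_n, hence so does the cluster point p. *)
have Np n : N n ((u n)^-1 * p).
  apply: (Hp [set z | N n ((u n)^-1 * z)] n) => [|k nk] /=.
    exact: closed_mull.
  have := uN n k 1 nk; rewrite mulg1; apply; exact: nbhs_singleton.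
have Nq n : N n q by apply: (Hq _ n) => // k nk; exact: Nmono nk _ (Ny k).
have W1pq : W1 (p * q).
  apply: (Hp [set z | W1 (z * q)] 0%N) => [|n _] /=; first exact: closed_mulr.
  exact: NW1.
have : (~` W°) (p * q).
  apply: (Hq [set z | (~` W°) (p * z)] 0%N) => [|n _] /=.
    apply: (@closed_mull _ _ (~` W°)) => //; apply: open_closedC.
    exact: open_interior.
  (* The factor y_n is excluded at stage n + 1, so p is written there as u_(n+1) z with z in
     N_(n+1). *)
  move=> /interior_subset; have [_ _ _ nW'] := Ry n.
  by have := nW' _ (Np n.+1); rewrite mulVKg.
by apply; have [] := W1W _ W1pq.
Qed.

(** Were continuity to fail, products of pairs near (1,1) that avoid [W] would form a proper filter.
    Quasi-continuity confines it to a translate of a compact set, which gives a cluster point z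
    different from 1. *)
Lemma mul_continuous1 (G : groupTopologyType) :
  semitopological_group G -> hausdorff_space G -> locally_compact [set: G] ->
  (fun p : G * G => p.1 * p.2) @ ((1 : G), (1 : G)) --> (1 : G).
Proof.
move=> sG T2 lcG W; wlog oW : W / open W.
  move=> wlg nW; have := wlg W° (open_interior _) (nbhs_interior nW).
  rewrite !nbhs_simpl /=; apply: filterS => z; exact: interior_subset.
move=> nW; rewrite nbhs_simpl /=; apply: contrapT => nnW.
pose mul := fun p : G * G => p.1 * p.2.
pose Fi := mul @ within (mul @^-1` ~` W) (nbhs ((1 : G), (1 : G))).
have FiP : ProperFilter Fi.
  apply: fmap_proper_filter; apply: Build_ProperFilter_ex => B nB.
  apply: contrapT => /forallNP B0; apply: nnW; move: nB.
  rewrite /within /=; apply: filterS => z Bz.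
  by apply: contrapT => nWz; apply: (B0 z); exact: Bz.
have [K nK cK] := locally_compact_nbhs G 1 lcG.
have [u [N [_ nN NK]]] := mul_quasi_continuous G K sG T2 lcG nK.
have [|z [_ clz]] := compact_mull G u K sG cK Fi.
  rewrite /Fi /fmap /= /within /=.
  exists (N, N) => // -[x y] [/= Nx Ny] _ /=.
  by rewrite /mul /= mulgA; exact: NK.
have nWz : (~` W) z.
  have Wcl : closed (~` W) by exact: open_closedC.
  apply: Wcl => B; apply: clz.
  exact: withinT.
have z1 : z <> 1 by move=> z1; apply: nWz; rewrite z1; exact: nbhs_singleton.
have T1 : closed [set z].
  by apply: accessible_closed_set1; exact: hausdorff_accessible.
have [|A [nA Acl Az]] := closed_nbhs_sub G 1 (~` [set z]) T2 lcG.
  apply: open_nbhs_nbhs; split; last by move=> /esym.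
  exact: closed_openC.
(* The condition on v is a neighbourhood of 1 as z is not in [A]. It keeps v z outside the closed
   set [A], yet v z clusters v [M] [M], which lies in [A]. *)
have [|v [M [[Av nAvz] nM MA]]] :=
    mul_quasi_continuous G (A `&` [set v | ~ A (v * z)]) sG T2 lcG.
  apply: filterI => //; apply: (@nbhs_mulr _ _ _ (~` A)) => //; rewrite mul1g.
  by apply: open_nbhs_nbhs; split; [exact: closed_openC|move=> /Az; exact].
have [|| w [[[x y] /= [Mx My] <-]]] :=
    clz [set mul p | p in M `*` M] [set w | (~` A) (v * w)].
- rewrite /Fi /fmap /= /within /=.
  by exists (M, M) => // p Mp _; exists p.
- apply: nbhs_mull => //.
  by apply: open_nbhs_nbhs; split=> //; exact: closed_openC.
- by rewrite /= /mul /= mulgA; apply; have [] := MA x y Mx My.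
Qed.

Lemma mul_continuous (G : groupTopologyType) :
  semitopological_group G -> hausdorff_space G -> locally_compact [set: G] ->
  continuous (fun p : G * G => p.1 * p.2).
Proof.
move=> sG T2 lcG -[g h] W /= nW.
have nW1 : nbhs 1 [set z | W (g * z * h)].
  apply: (@nbhs_mull _ _ _ [set z | W (z * h)]) => //; rewrite mulg1.
  exact: nbhs_mulr.
have [[N M] [/= nN nM] NM] := mul_continuous1 G sG T2 lcG _ nW1.
exists ([set x | N (g^-1 * x)], [set y | M (y * h^-1)]).
  split=> /=; first by apply: nbhs_mull => //; rewrite mulVg.
  by apply: nbhs_mulr => //; rewrite mulgV.
move=> [x y] [/= Nx My]; have := NM (g^-1 * x, y * h^-1) (conj Nx My).
by rewrite /= !mulgA mulgV mul1g mulgVK.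
Qed.

(** As x tends to an interior point v, x^-1 stays in the compact set [V]; joint continuity forces
    every cluster point q to satisfy v q = 1. Translation handles the other points. *)
Lemma inv_continuous (G : groupTopologyType) (V : set G) :
  semitopological_group G -> hausdorff_space G ->
  continuous (fun p : G * G => p.1 * p.2) ->
  compact V -> symmetric_set V -> V° !=set0 ->
  continuous (fun x : G => x^-1).
Proof.
move=> sG T2 mulC cV Vsym [v Vv].
have invv : (fun x : G => x^-1) @ v --> v^-1.
  move=> W nW; rewrite nbhs_simpl /=; apply: contrapT => nnW.
  pose Fi := (fun x : G => x^-1) @ within [set x | ~ W x^-1] (nbhs v).
  have FiP : ProperFilter Fi.
    apply: fmap_proper_filter; apply: Build_ProperFilter_ex => B nB.
    apply: contrapT => /forallNP B0; apply: nnW; move: nB.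
    rewrite /within /=; apply: filterS => z Bz.
    by apply: contrapT => nWz; apply: (B0 z); exact: Bz.
  have [|q [Vq clq]] := cV Fi.
    rewrite /Fi /fmap /= /within /=; apply: filterS Vv => x Vx _.
    exact: symmetric_setV.
  have vq1 : v * q = 1.
    apply: contrapT => vq1.
    have T1 : closed [set (1 : G)].
      by apply: accessible_closed_set1; exact: hausdorff_accessible.
    have [|[N M] [/= nN nM] NM] := mulC (v, q) (~` [set 1]).
      by apply: open_nbhs_nbhs; split=> //; exact: closed_openC.
    have [|_ [[x Nx <-] Mx]] := clq [set x^-1 | x in N] M _ nM.
      rewrite /Fi /fmap /= /within /=.
      by apply: filterS nN => x Nx _; exists x.
    by apply: (NM (x, x^-1)) => //=; rewrite mulgV.
  have qv : q = v^-1 by rewrite -(mulKg v q) vq1 mulg1.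
  rewrite -qv in nW; have [|x []] := clq (~` W) W _ nW => //.
  exact: withinT.
(* Here a g = v and x^-1 = (a x)^-1 a, which reduces continuity at g to continuity at v. *)
move=> g W /= nW; pose a := v * g^-1.
have nWa : nbhs v^-1 [set z | W (z * a)] by apply: nbhs_mulr => //; rewrite mulKg.
have : nbhs (a * g) [set x | W (x^-1 * a)] by rewrite mulgVK; exact: invv nWa.
move=> /(nbhs_mull _ _ _ _ sG); apply: filterS => x /=.
by rewrite invgM mulgVK.
Qed.

Theorem theorem2p24 (G : groupTopologyType) (C : set (set G)) :
  semitopological_group G ->
  covering C ->
  coherent C ->
  (forall A, C A -> closed A) ->
  (forall A, C A -> symmetric_set A) ->
  (forall A B, C A -> C B -> exists2 D, C D & mulset A B `<=` D) ->
  (forall V : set G, generic_piece C V ->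
     V° !=set0 /\
     (compact_hausdorff (set_type V) ->
        topological_group G /\ locally_compact [set: G])) /\
  (countable C -> (forall A, C A -> compact_hausdorff (set_type A)) ->
     (locally_compact [set: G] /\ hausdorff_space G <->
      exists V : set G, generic_piece C V)).
Proof.
move=> sG cov coh Ccl Csym Cmul.
have gen_int V : generic_piece C V -> V° !=set0 by exact: generic_piece_interior.
have gen_T2 V : generic_piece C V -> compact_hausdorff (set_type V) ->
    hausdorff_space G /\ locally_compact [set: G].
  move=> Vgen [Vc VT2]; have Vcl := Ccl V Vgen.1; have V0 := gen_int V Vgen.
  split; first exact: hausdorff_set_type_interior VT2 V0.
  exact: locally_compact_interior (compact_set_type _ V Vc) V0.
split=> [V Vgen|Ccount CcT2].
  split=> [|VcT2]; first exact: gen_int.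
  have [T2 lcG] := gen_T2 V Vgen VcT2; split=> //.
  have mulC := mul_continuous G sG T2 lcG; split=> //.
  apply: inv_continuous (gen_int V Vgen) => //; last exact: (Csym V Vgen.1).
  by apply: compact_set_type; case: VcT2.
split=> [[lcG T2]|[V Vgen]]; last first.
  by have [T2 lcG] := gen_T2 V Vgen (CcT2 V Vgen.1).
have [A0 CA0 _] : (\bigcup_(A in C) A) (1 : G) by rewrite cov.
have /countable_injP[f finj] := Ccount.
(* [A0] fills the indices that [f] does not attain on [C], so every [F n] is a piece. *)
pose F n := xget A0 [set A | C A /\ f A = n].
have CF n : C (F n) by rewrite /F; case: xgetP => [A _ []|].
have FC A : C A -> F (f A) = A.
  move=> CA; have [CFA fFA] : [set B | C B /\ f B = f A] (F (f A)).
    by apply: xgetPex; exists A.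
  by apply: finj => //; apply: mem_set.
have [||n Fn] := baire_locally_compact G F 1 T2 lcG.
- by move=> n; apply: Ccl.
- rewrite -subTset => x _; have [A CA Ax] : (\bigcup_(A in C) A) x by rewrite cov.
  by exists (f A) => //; rewrite FC.
exists (F n); split=> // W CW; apply: compact_finite_index => //.
by apply: compact_set_type; case: (CcT2 W CW).
Qed.
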